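(* Let $A$ be a real $n \times n$ matrix that is diagonally stable, and let $\mathcal{D}(A)$ be the set of all its Lyapunov scaling factors. Then $A$ is diagonally $\mathbb{C}^0_\theta$-stable for any value of $\theta$ which satisfies $$\frac{\pi}{2} > \theta > \arctan \inf_{D \in \mathcal{D}(A)} \|\mathrm{Skew}(DA)\|\,\|(\mathrm{Sym}(DA))^{-1}\|.$$
   Context: A positive diagonal matrix is a diagonal matrix with all diagonal entries $>0$. A real $n\times n$ matrix $A$ is called diagonally stable if there is a positive diagonal matrix $D$ such that $DA + A^T D$ is negative definite; any such $D$ is called a Lyapunov scaling factor of $A$, and $\mathcal{D}(A)$ denotes the set of all of them. Notation: $\mathrm{Sym}(M) = \frac{M+M^T}{2}$, $\mathrm{Skew}(M) = \frac{M - M^T}{2}$, and $\|M\| = \sup_{\|x\|=1}\|Mx\|$ is the operator norm induced by the Euclidean norm. For $0<\theta<\frac{\pi}{2}$, a real $n\times n$ matrix $M$ is called diagonally $\mathbb{C}^0_\theta$-stable if there exists a positive diagonal matrix $D$ such that the symmetric $2n \times 2n$ matrix $$W(M,D) = \begin{pmatrix} \sin(\theta) DM & \cos(\theta) DM \\ -\cos(\theta) DM & \sin(\theta) DM \end{pmatrix} + \begin{pmatrix} \sin(\theta) M^T D & -\cos(\theta) M^T D \\ \cos(\theta) M^T D & \sin(\theta) M^T D \end{pmatrix}$$ is negative definite. *)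

(* Defs.v *)
From mathcomp Require Import all_boot all_order all_algebra.
From mathcomp Require Import all_classical all_reals all_analysis.

Set Implicit Arguments.
Unset Strict Implicit.
Unset Printing Implicit Defensive.

Import Order.TTheory GRing.Theory Num.Theory.

Local Open Scope classical_set_scope.
Local Open Scope ring_scope.

Definition neg_definite (R : realType) (m : nat) (M : 'M[R]_m) : Prop :=
  M \is symmetricmx /\
  forall x : 'cV[R]_m, x != 0 -> (x^T *m M *m x) 0 0 < 0.

Definition pos_diag (R : realType) (n : nat) (D : 'M[R]_n) : Prop :=
  is_diag_mx D /\ forall i : 'I_n, 0 < D i i.

Definition Sym (R : realType) (n : nat) (M : 'M[R]_n) : 'M[R]_n :=
  2^-1 *: (M + M^T).

Definition Skew (R : realType) (n : nat) (M : 'M[R]_n) : 'M[R]_n :=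
  2^-1 *: (M - M^T).

(* The norm `|x| that the library puts on matrices is the max norm, hence a
   separate definition of the Euclidean norm and of the norm it induces. *)
Definition enorm (R : realType) (n : nat) (x : 'cV[R]_n) : R :=
  Num.sqrt (\sum_(i < n) x i 0 ^+ 2).

Definition opnorm (R : realType) (n : nat) (M : 'M[R]_n) : R :=
  sup [set enorm (M *m x) | x in [set x : 'cV[R]_n | enorm x = 1]].

Definition lyapunov_factors (R : realType) (n : nat) (A : 'M[R]_n) :
    set 'M[R]_n :=
  [set D | pos_diag D /\ neg_definite (D *m A + A^T *m D)].

Definition diag_stable (R : realType) (n : nat) (A : 'M[R]_n) : Prop :=
  exists D : 'M[R]_n, lyapunov_factors A D.

Definition Wmx (R : realType) (n : nat) (theta : R) (M D : 'M[R]_n) :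
    'M[R]_(n + n) :=
  block_mx (sin theta *: (D *m M))      (cos theta *: (D *m M))
           (- cos theta *: (D *m M))    (sin theta *: (D *m M))
  + block_mx (sin theta *: (M^T *m D))  (- cos theta *: (M^T *m D))
             (cos theta *: (M^T *m D))  (sin theta *: (M^T *m D)).

(* Meant for 0 < theta < pi / 2. *)
Definition diag_C0_stable (R : realType) (n : nat) (theta : R) (M : 'M[R]_n) :
    Prop :=
  exists D : 'M[R]_n, pos_diag D /\ neg_definite (Wmx theta M D).

(* Main.v *)
Require Import Defs.
From mathcomp Require Import all_boot all_order all_algebra.
From mathcomp Require Import all_classical all_reals all_analysis.
From mathcomp Require Import ring lra.

Set Implicit Arguments.
Unset Strict Implicit.

Import Order.TTheory GRing.Theory Num.Theory.

Local Open Scope classical_set_scope.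
Local Open Scope ring_scope.

(* The strict inequality on theta provides a scaling factor D with k b < tan theta, where
   k = |Skew (D A)| and b = |(Sym (D A))^-1|.  Put S = Sym (D A) and K = Skew (D A).
   At the vector (x, y) the quadratic form of W is
   2 sin theta (x^T S x + y^T S y) + 4 cos theta x^T K y.  Its last term is at most
   2 cos theta k (|x|^2 + |y|^2), while |x|^2 <= - b x^T S x. *)

Section EuclideanForm.
Context {R : realType}.

(** At [1%:M] this is the Euclidean inner product, so norms and quadratic forms share the same
    algebra. *)
Definition form n (M : 'M[R]_n) (x y : 'cV[R]_n) : R := (x^T *m M *m y) 0 0.

Lemma formDl n (M : 'M[R]_n) x y z : form M (x + y) z = form M x z + form M y z.
Proof. by rewrite /form linearD !mulmxDl mxE. Qed.

Lemma formDr n (M : 'M[R]_n) x y z : form M z (x + y) = form M z x + form M z y.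
Proof. by rewrite /form mulmxDr mxE. Qed.

Lemma formZl n (M : 'M[R]_n) a x y : form M (a *: x) y = a * form M x y.
Proof. by rewrite /form linearZ -!scalemxAl mxE. Qed.

Lemma formZr n (M : 'M[R]_n) a x y : form M x (a *: y) = a * form M x y.
Proof. by rewrite /form -scalemxAr mxE. Qed.

Lemma form_scale n (M : 'M[R]_n) a x y : form (a *: M) x y = a * form M x y.
Proof. by rewrite /form -scalemxAr -scalemxAl mxE. Qed.

Lemma form_mull n (M N : 'M[R]_n) x y : form M (N *m x) y = form (N^T *m M) x y.
Proof. by rewrite /form trmx_mul !mulmxA. Qed.

Lemma form_mulr n (M N : 'M[R]_n) x y : form M x (N *m y) = form (M *m N) x y.
Proof. by rewrite /form !mulmxA. Qed.

Lemma formC n (M : 'M[R]_n) x y : form M x y = form M^T y x.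
Proof. by rewrite /form -[x^T *m M *m y]trmxK [LHS]mxE !trmx_mul trmxK mulmxA. Qed.

Lemma form_block n (M N P Q : 'M[R]_n) x y :
  form (block_mx M N P Q) (col_mx x y) (col_mx x y) =
  form M x x + form P y x + (form N x y + form Q y y).
Proof. by rewrite /form tr_col_mx mul_row_block mul_row_col !mulmxDl !mxE. Qed.

Lemma enorm_ge0 n (x : 'cV[R]_n) : 0 <= enorm x.
Proof. exact: sqrtr_ge0. Qed.

Lemma sqr_enorm n (x : 'cV[R]_n) : enorm x ^+ 2 = form 1%:M x x.
Proof.
rewrite sqr_sqrtr; last by apply: sumr_ge0 => i _; exact: sqr_ge0.
by rewrite /form mulmx1 mxE; apply: eq_bigr => i _; rewrite mxE expr2.
Qed.

Lemma enorm_eq0 n (x : 'cV[R]_n) : (enorm x == 0) = (x == 0).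
Proof.
apply/idP/eqP => [|->]; last first.
  by rewrite -sqrf_eq0 sqr_enorm /form mulmx0 mxE.
rewrite -sqrf_eq0 sqr_sqrtr; last by apply: sumr_ge0 => i _; exact: sqr_ge0.
rewrite psumr_eq0 => [/allP x0|i _]; last exact: sqr_ge0.
apply/colP => i; rewrite mxE; apply/eqP; rewrite -sqrf_eq0.
by apply: x0; rewrite mem_index_enum.
Qed.

Lemma enormZ n (a : R) (x : 'cV[R]_n) : enorm (a *: x) = `|a| * enorm x.
Proof.
rewrite /enorm -sqrtr_sqr -sqrtrM ?sqr_ge0// mulr_sumr.
by congr Num.sqrt; apply: eq_bigr => i _; rewrite mxE exprMn.
Qed.

(** Each coordinate of a unit vector has absolute value at most 1, so the absolute row sums of [M]
    bound the coordinates of [M *m x]. *)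
Lemma opnorm_has_ubound n (M : 'M[R]_n) :
  has_ubound [set enorm (M *m x) | x in [set x : 'cV[R]_n | enorm x = 1]].
Proof.
exists (Num.sqrt (\sum_i (\sum_j `|M i j|) ^+ 2)) => _ [x /= x1 <-].
have xle1 j : `|x j 0| <= 1.
  rewrite -x1 -sqrtr_sqr ler_wsqrtr// (bigD1 j)//= lerDl.
  by apply: sumr_ge0 => i _; exact: sqr_ge0.
apply: ler_wsqrtr; apply: ler_sum => i _; rewrite -real_normK ?num_real//.
rewrite ler_sqr ?nnegrE ?normr_ge0 ?sumr_ge0// mxE.
apply: (le_trans (ler_norm_sum _ _ _)); apply: ler_sum => j _.
by rewrite normrM ler_piMr.
Qed.

Lemma opnorm_ge0 n (M : 'M[R]_n) : 0 <= opnorm M.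
Proof.
rewrite /opnorm; set E := image _ _.
(* In dimension 0 there is no unit vector, and [sup] of the empty set is 0 by convention. *)
have [->|/set0P[r Er]] := eqVneq E set0; first by rewrite sup0.
apply: (@le_trans _ _ r); first by case: Er => x _ <-; exact: enorm_ge0.
exact: (ub_le_sup (opnorm_has_ubound M)).
Qed.

Lemma enorm_mulmx_le n (M : 'M[R]_n) (x : 'cV[R]_n) :
  enorm (M *m x) <= opnorm M * enorm x.
Proof.
have [->|x0] := eqVneq x 0; first by rewrite mulmx0 (eqP (_ : enorm 0 == 0)) ?mulr0 ?enorm_eq0.
have ex_gt0 : 0 < enorm x by rewrite lt_def enorm_eq0 x0 enorm_ge0.
rewrite -ler_pdivrMr//.
have -> : enorm (M *m x) / enorm x = enorm (M *m ((enorm x)^-1 *: x)).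
  by rewrite -scalemxAr enormZ gtr0_norm ?invr_gt0// mulrC.
apply: (ub_le_sup (opnorm_has_ubound M)); exists ((enorm x)^-1 *: x) => //=.
by rewrite enormZ gtr0_norm ?invr_gt0// mulVf// gt_eqF.
Qed.

(* AM-GM: 2 k <x, M y> <= k^2 |x|^2 + |M y|^2 <= k^2 (|x|^2 + |y|^2) *)
Lemma form_le_opnorm n (M : 'M[R]_n) (x y : 'cV[R]_n) :
  2 * form M x y <= opnorm M * (enorm x ^+ 2 + enorm y ^+ 2).
Proof.
set k := opnorm M; have k0 : 0 <= k := opnorm_ge0 M.
have My : enorm (M *m y) <= k * enorm y := enorm_mulmx_le M y.
(* The AM-GM inequality carries a factor [k] to be cancelled; if [k] is 0, then [M *m y] vanishes
   instead. *)
have [k_eq0|k_gt0] := leP k 0.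
  have kE : k = 0 by apply/le_anti; rewrite k_eq0.
  move: My; rewrite kE !mul0r => My0.
  have /eqP : enorm (M *m y) == 0 by rewrite eq_le My0 enorm_ge0.
  move/eqP; rewrite enorm_eq0 => /eqP My0'.
  by rewrite /form -mulmxA My0' mulmx0 mxE mulr0.
have : 0 <= enorm (k *: x + (-1) *: (M *m y)) ^+ 2 by exact: sqr_ge0.
rewrite sqr_enorm formDl !formDr !formZl !formZr -!sqr_enorm.
rewrite (formC _ (M *m y)) trmx1 form_mulr mul1mx => H.
have : enorm (M *m y) ^+ 2 <= (k * enorm y) ^+ 2.
  by rewrite ler_sqr ?nnegrE ?mulr_ge0 ?enorm_ge0.
move=> H2; rewrite -(ler_pM2l k_gt0); nra.
Qed.

(** A nonzero kernel vector would make the quadratic form vanish. *)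
Lemma neg_definite_unitmx n (S : 'M[R]_n) : neg_definite S -> S \in unitmx.
Proof.
move=> [_ Sneg]; rewrite -row_free_unit; apply: inj_row_free => v vS0.
apply/eqP/negP => /negP; rewrite -(inj_eq trmx_inj) trmx0 => /Sneg.
by rewrite trmxK vS0 mul0mx mxE ltxx.
Qed.

(* Evaluating the form of S at b x + S^-1 x avoids the spectral theorem. *)
Lemma neg_definite_form_le n (S : 'M[R]_n) (x : 'cV[R]_n) :
  neg_definite S -> enorm x ^+ 2 <= - (opnorm (invmx S) * form S x x).
Proof.
move=> Sneg; have Su := neg_definite_unitmx Sneg.
case: Sneg => /is_hermitianmxP; rewrite expr0 scale1r map_mx_id// => Ssym Sneg.
have [->|x0] := eqVneq x 0.
  by rewrite sqr_enorm /form !mulmx0 !mxE mulr0 oppr0.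
set Q := invmx S; set b := opnorm Q; set z := b *: x + Q *m x.
have SQ : S *m Q = 1%:M by rewrite mulmxV.
have QTS : Q^T *m S = 1%:M by rewrite Ssym -trmx_mul SQ trmx1.
have Qx0 : Q *m x != 0.
  apply: contra x0 => /eqP Qx0; rewrite -[x]mul1mx -SQ -mulmxA Qx0 mulmx0.
  exact: eqxx.
(* If [b] were 0, then [Q *m x] would vanish, although [Q] is injective. *)
have b_gt0 : 0 < b.
  rewrite lt_def opnorm_ge0 andbT; apply: contra Qx0 => /eqP b0.
  by rewrite -enorm_eq0 eq_le enorm_ge0 andbT -[leRHS](mul0r (enorm x)) -b0 enorm_mulmx_le.
have zSz : form S z z = b ^+ 2 * form S x x + 2 * b * enorm x ^+ 2 + form Q x x.
  rewrite formDl !formDr !formZl !formZr !form_mull !form_mulr SQ QTS mul1mx.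
  by rewrite sqr_enorm; ring.
have zSz_le0 : form S z z <= 0.
  have [->|z0] := eqVneq z 0; first by rewrite /form mulmx0 mxE.
  exact: ltW (Sneg z z0).
(* The pair [x], [- x] yields - x^T Q x <= b |x|^2. Inserted in z^T S z <= 0, this leaves b^2 x^T S
   x + b |x|^2 <= 0, and [b] cancels. *)
have := form_le_opnorm Q x (- x); rewrite -scaleN1r enormZ normrN1 mul1r formZr -/b.
move=> Qx_ge; rewrite -(ler_pM2l b_gt0); nra.
Qed.

Lemma neg_definiteZ n (a : R) (M : 'M[R]_n) :
  0 < a -> neg_definite M -> neg_definite (a *: M).
Proof.
move=> a_gt0 [/is_hermitianmxP]; rewrite expr0 scale1r map_mx_id// => Msym Mneg.
split.
  by apply/is_hermitianmxP; rewrite expr0 scale1r map_mx_id// linearZ/= -Msym.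
move=> x x0; rewrite -[X in X < 0]/(form _ _ _) form_scale pmulr_rlt0//.
exact: Mneg.
Qed.

Lemma block_neg_definite n (S K : 'M[R]_n) (s c : R) :
  neg_definite S -> K^T = - K -> 0 < c ->
  opnorm K * opnorm (invmx S) * c < s ->
  neg_definite (block_mx (s *: S) (c *: K) (- c *: K) (s *: S)).
Proof.
move=> Sneg KT c_gt0 kbc_lt; split.
  case: Sneg => /is_hermitianmxP; rewrite expr0 scale1r map_mx_id// => Ssym _.
  apply/is_hermitianmxP; rewrite expr0 scale1r map_mx_id// tr_block_mx.
  by rewrite !linearZ/= -Ssym KT !scalerN !scaleNr opprK.
move=> z; rewrite -(vsubmxK z); set x := usubmx z; set y := dsubmx z => z0.
rewrite -[X in X < 0]/(form _ _ _) form_block !form_scale.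
(* By skewness both off-diagonal blocks contribute the same amount, c x^T K y. *)
have -> : form K y x = - form K x y.
  by rewrite formC KT -scaleN1r form_scale mulN1r.
have norm_gt0 : 0 < enorm x ^+ 2 + enorm y ^+ 2.
  rewrite lt_def addr_ge0 ?sqr_ge0// andbT paddr_eq0 ?sqr_ge0// !sqrf_eq0.
  by rewrite !enorm_eq0; apply: contra z0 => /andP[/eqP-> /eqP->]; rewrite col_mx0.
have Kxy := form_le_opnorm K x y.
have := neg_definite_form_le x Sneg; have := neg_definite_form_le y Sneg.
have := opnorm_ge0 K; have := opnorm_ge0 (invmx S).
move: c_gt0 kbc_lt Kxy norm_gt0.
set k := opnorm K; set b := opnorm _; set X := enorm x ^+ 2; set Y := enorm y ^+ 2.
set p := form S x x; set q := form S y y; set f := form K x y.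
clearbody k b X Y p q f => {S K x y z z0 Sneg KT}.
move=> c_gt0 kbc_lt Kxy norm_gt0 b_ge0 k_ge0 yS xS.
(* Strict positivity follows from 0 < X + Y <= - b (p + q) with b >= 0; it preserves the strict
   inequality in [H3]. *)
have pq_gt0 : 0 < - (p + q).
  have : 0 < b * - (p + q) by lra.
  by apply: contraTT; rewrite -!leNgt; exact: mulr_ge0_le0.
have ck_ge0 : 0 <= c * k by rewrite mulr_ge0// ltW.
(* The chain is 2 c f <= c k (X + Y) <= - c k b (p + q) < - s (p + q). *)
have H1 : 2 * c * f <= c * k * (X + Y) by nra.
have H2 : c * k * (X + Y) <= c * k * (b * - (p + q)).
  by rewrite ler_wpM2l//; lra.
have H3 : k * b * c * - (p + q) < s * - (p + q) by rewrite ltr_pM2r.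
lra.
Qed.

End EuclideanForm.

Theorem theorem7 (R : realType) (n : nat) (A : 'M[R]_n) (hA : diag_stable A)
    (theta : R) (htheta_lt : theta < pi / 2)
    (htheta_gt :
       atan (inf [set opnorm (Skew (D *m A)) * opnorm (invmx (Sym (D *m A)))
                 | D in lyapunov_factors A]) < theta) :
  diag_C0_stable theta A.
Proof.
set E := [set _ | _ in _] in htheta_gt.
(* Diagonal stability makes [E] nonempty, as required to extract an element of [E] below tan
   theta. *)
have E0 : E !=set0 by case: hA => D hD; eexists; exists D.
have theta_itv : - (pi / 2) < theta < pi / 2.
  by rewrite htheta_lt (lt_trans _ htheta_gt)// atan_gtNpi2.
have inf_lt_tan : inf E < tan theta.
  rewrite ltNge; apply/negP => /le_atan; rewrite tanK ?in_itv//.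
  by rewrite leNgt htheta_gt.
have [_ [D [Dpos Dneg] <-] kb_lt] := inf_lt E0 inf_lt_tan.
exists D; split=> //; set M := D *m A in Dneg kb_lt *.
(* A diagonal [D] equals its transpose. *)
have MT : A^T *m D = M^T.
  rewrite trmx_mul; congr (_ *m _); case: Dpos => /is_diag_mxP D0 _.
  apply/matrixP => i j; rewrite mxE; have [->//|ij] := eqVneq i j.
  by rewrite !D0// eq_sym.
rewrite MT in Dneg.
(* The blocks of W are multiples of M + M^T and M - M^T; the factor 2 offsets the halves in [Sym]
   and [Skew]. *)
have WE : Wmx theta A D = 2 *: block_mx (sin theta *: Sym M) (cos theta *: Skew M)
    (- cos theta *: Skew M) (sin theta *: Sym M).
  rewrite /Wmx MT -/M add_block_mx scale_block_mx /Sym /Skew.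
  rewrite ![2 *: (_ *: _)]scalerA !(mulrC 2) -!scalerA.
  rewrite !(scalerA 2) divff ?pnatr_eq0// !scale1r.
  by rewrite !scalerBr !scalerDr !scaleNr opprK [- _ + _]addrC.
have c_gt0 : 0 < cos theta by exact: cos_gt0_pihalf.
rewrite WE; apply: neg_definiteZ => //; apply: block_neg_definite => //.
- by apply: neg_definiteZ => //; rewrite invr_gt0.
- by rewrite linearZ/= linearB/= trmxK -scalerN opprB.
(* Dividing by cos theta > 0 turns the goal into the bound by tan theta. *)
- by rewrite -ltr_pdivlMr.
Qed.
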